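(* Let $n\ge1$ and let $\alpha\vDash n$ be a composition of length $\ell$. Let $\beta^\psi_\alpha=(c_i)_i$, where $c_i$ is the number of cells in the $i$-th column of the diagram of $\alpha$ (for $1\le i\le\max_j\alpha_j$). Then the leading term (with respect to the lexicographic order) in the $\mathfrak{S}^*$-expansion of $\psi(\mathfrak{S}^*_\alpha)$ is indexed by $\beta^\psi_\alpha$, and $[\mathfrak{S}^*_{\beta^\psi_\alpha}]\psi(\mathfrak{S}^*_\alpha)=1$. Moreover, there is a unique row-strict semi-standard immaculate tableau $T^{\psi,M}_\alpha$ of shape $\alpha$ and content $\beta^\psi_\alpha$, and it is such that column $i$ is filled with entries $i$ for every $i$.
   Context: A composition $\alpha=(\alpha_1,\dots,\alpha_\ell)\vDash n$ is a finite list of positive integers with sum $n$; $\ell$ is its length. Write $\mathrm{Set}(\alpha)=\{\alpha_1,\alpha_1+\alpha_2,\dots,\alpha_1+\cdots+\alpha_{\ell-1}\}\subseteq[n-1]=\{1,\dots,n-1\}$, and let $\mathrm{Comp}$ be the inverse bijection from subsets of $[n-1]$ to compositions of $n$. The complement is $\alpha^c=\mathrm{Comp}([n-1]\setminus\mathrm{Set}(\alpha))$. Lexicographic order on compositions of $n$: $\beta\le_l\alpha$ if $\beta=\alpha$ or $\beta_i<\alpha_i$ at the minimal index $i$ with $\beta_i\ne\alpha_i$. In the variables $x_1,x_2,\dots$, $M_\alpha=\sum_{i_1<\cdots<i_\ell}x_{i_1}^{\alpha_1}\cdots x_{i_\ell}^{\alpha_\ell}$; $\mathrm{QSym}^n$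 is the $\mathbb{Z}$-span of $\{M_\alpha\mid\alpha\vDash n\}$, $\mathrm{QSym}=\bigoplus_{n\ge 0}\mathrm{QSym}^n$. The fundamental quasisymmetric functions are $F_\alpha=\sum_{\beta\preceq\alpha}M_\beta$, where $\beta\preceq\alpha$ means that the parts of $\alpha$ are obtained in order by adding adjacent parts of $\beta$; they form a basis. The linear map $\psi:\mathrm{QSym}\to\mathrm{QSym}$ is defined by $\psi(F_\alpha)=F_{\alpha^c}$. The diagram of $\alpha$ is the left-justified array of cells with $\alpha_i$ cells in row $i$, rows numbered from bottom to top, columns from left to right. The content of a filling by positive integers is the sequence $\beta$ with $\beta_i$ the number of entries equal to $i$. A semi-standard immaculate tableau of shape $\alpha$ is a filling of the diagram of $\alpha$ by positive integers with entries strictly increasing from bottom to top in the first (leftmost) column and weakly increasing from left to right in each row. A row-strict semi-standard immaculate tableau of shape $\alpha$ is a filling with entries weakly increasing from bottom to top in the first column and strictly increasing from left to right in each row. The dual immaculate function is $\mathfrak{S}^*_\alpha=\sum_{\beta\vDash n}K_{\alpha,\beta}M_\beta$, with $K_{\alpha,\beta}$ the number of semi-standard immaculate tableaux of shape $\alpha$ and content $\beta$; $\{\mathfrak{S}^*_\alpha\}_{\alpha\vDash n}$ is a $\mathbb{Z}$-basis of $\mathrm{QSym}^n$. For a basis element $B$, $[B]G$ denotes the coefficient of $B$ in the expansion of $G$. The leading term of the expansion of a nonzero $G\in\mathrm{QSym}^n$ in a basis indexed by compositions of $n$ is the term with nonzero coefficient whose index is largest in lexicographic order. *)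

(* Defs.v *)
From HB Require Import structures.
From mathcomp Require Import all_boot all_order all_algebra finmap.
From mathcomp Require Import boolp classical_sets functions cardinality.

Set Implicit Arguments.
Unset Strict Implicit.
Unset Printing Implicit Defensive.

Import GRing.Theory.
Local Open Scope ring_scope.

Definition is_comp (n : nat) (s : seq nat) : bool :=
  all (leq 1) s && (sumn s == n).

Record composition (n : nat) := Comp { cval :> seq nat; compP : is_comp n cval }.

HB.instance Definition _ n := [isSub for @cval n].
HB.instance Definition _ n := [Countable of composition n by <:].

Lemma comp_size n (a : composition n) : (size a <= n)%N.
Proof.
case: a => s /= /andP[pos /eqP <-]; elim: s pos => //= x s IHs /andP[x0 /IHs].
by move=> le_s; rewrite -add1n leq_add.
Qed.

Lemma comp_part_le n (a : composition n) x : x \in cval a -> (x <= n)%N.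
Proof.
case: a => s /= /andP[_ /eqP <-]; elim: s => //= y s IHs.
by rewrite inE => /orP[/eqP -> | /IHs le_s]; rewrite ?leq_addr // (leq_trans le_s) ?leq_addl.
Qed.

Definition comp_code n (a : composition n) : n.-bseq 'I_n.+1 :=
  insub_bseq n [seq inord i | i <- a].
Definition comp_decode n (b : n.-bseq 'I_n.+1) : option (composition n) :=
  insub [seq val i | i <- b].

Lemma comp_codeK n : pcancel (@comp_code n) (@comp_decode n).
Proof.
move=> a; rewrite /comp_decode /comp_code /insub_bseq val_insubd size_map comp_size.
rewrite -map_comp map_id_in ?valK // => x xa /=.
by rewrite inordK // ltnS (comp_part_le xa).
Qed.

HB.instance Definition _ n :=
  isFinite.Build (composition n) (pcan_enumP (@comp_codeK n)).

Definition comp_set (s : seq nat) : seq nat :=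
  [seq sumn (take k s) | k <- iota 1 (size s).-1].

(* The parts of Comp(S) are the successive differences of 0 :: S together
   with n; listing n among the marks only when n > 0 makes the only
   composition of 0 the empty one. *)
Definition set_comp (n : nat) (S : seq nat) : seq nat :=
  pairmap (fun a b => b - a)%N 0%N [seq i <- iota 1 n | (i \in S) || (i == n)].


Lemma pairmap_subn k l : path ltn k l ->
  all (leq 1) (pairmap (fun a b => b - a)%N k l)
  && (sumn (pairmap (fun a b => b - a)%N k l) + k == last k l)%N.
Proof.
elim: l k => [|x l IHl] k /=; first by rewrite eqxx.
case/andP=> ltkx /IHl /andP[-> /eqP <-]; rewrite subn_gt0 ltkx /=.
by rewrite addnAC subnK ?(ltnW ltkx) // addnC.
Qed.

Lemma set_comp_subproof n S : is_comp n (set_comp n S).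
Proof.
rewrite /is_comp /set_comp; set l := filter _ _.
have pl : path ltn 0 l.
  have pi k : path ltn k (iota k.+1 n).
    by elim: n k {l} => //= n IHn k; rewrite ltnSn IHn.
  apply: (subseq_path ltn_trans) (pi 0%N); exact: filter_subseq.
have ll : last 0%N l = n.
  rewrite /l; case: n {l pl} => // n.
  by rewrite -[in iota _ _](addn1 n) iotaD filter_cat last_cat /= add1n eqxx orbT.
by have := pairmap_subn pl; rewrite ll addn0.
Qed.

Definition Comp_of_set n (S : seq nat) : composition n :=
  Comp (set_comp_subproof n S).

Definition compl n (a : composition n) : composition n :=
  Comp_of_set n [seq i <- iota 1 n.-1 | i \notin comp_set a].

(* b refines a: the blocks of consecutive parts of b are automatically
   nonempty, the parts of a being positive. *)
Definition refines n (b a : composition n) : bool :=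
  `[< exists bs : seq (seq nat),
        flatten bs = cval b /\ [seq sumn t | t <- bs] = cval a >].

(* Compositions of the same n are never proper prefixes of one another, so
   the treatment of prefixes in seqlexi plays no role. *)
Definition lexle n (b a : composition n) : bool :=
  ((cval b : seqlexi nat) <= cval a)%O.

(* Formal power series with integer coefficients in countably many variables,
   which are numbered from 0. *)

Definition monomial := {fsfun nat -> nat with 0%N}.
Definition series := monomial -> int^o.

(* The condition says that m is the product of the x_(i_j)^(s_j) for some
   i_0 < i_1 < ...; as the parts of a composition are positive, the sequence i
   is determined by m, so the coefficients of Mseries s are 0 or 1. *)
Definition Mseries (s : seq nat) : series := fun m =>
  (`[< exists i : seq nat, [/\ sorted ltn i, size i = size s &
       forall k, m k =
         (\sum_(j < size s | nth 0 i j == k) nth 0 s j)%N] >])%:R.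

Definition is_qsym (f : series) : Prop :=
  exists (N : nat) (c : forall n, composition n -> int),
    f = \sum_(n < N) \sum_(a : composition n) c n a *: Mseries a.

Definition qsym_pred : {pred series} := fun f => `[< is_qsym f >].

Lemma qsym_submod_closed : submod_closed qsym_pred.
Proof.
have widen N N' (c : forall n, composition n -> int) : (N <= N')%N ->
    \sum_(n < N) \sum_(a : composition n) c n a *: Mseries a =
    \sum_(n < N') \sum_(a : composition n)
       (if (n < N)%N then c n a else 0) *: Mseries a.
  move=> le_NN'; rewrite (big_ord_widen N'
    (fun n => \sum_(a : composition n) c n a *: Mseries a)) //.
  rewrite big_mkcond; apply: eq_bigr => n _; case: ifP => // _.
  by rewrite big1 // => a _; rewrite scale0r.
split; first by apply/asboolP; exists 0%N, (fun _ _ => 0); rewrite big_ord0.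
move=> k f g /asboolP[N [c ->]] /asboolP[N' [c' ->]]; apply/asboolP.
rewrite (widen N (maxn N N')) ?leq_maxl // (widen N' (maxn N N')) ?leq_maxr //.
exists (maxn N N'), (fun n a => k * (if (n < N)%N then c n a else 0) +
                                (if (n < N')%N then c' n a else 0)).
rewrite scaler_sumr -big_split; apply: eq_bigr => n _ /=.
rewrite scaler_sumr -big_split; apply: eq_bigr => a _ /=.
by rewrite scalerDl scalerA.
Qed.

HB.instance Definition _ :=
  GRing.isSubmodClosed.Build int series qsym_pred qsym_submod_closed.

Record qsym := QSym { qseries :> series; qsymP : qseries \in qsym_pred }.

HB.instance Definition _ := [isSub for qseries].
HB.instance Definition _ := [Choice of qsym by <:].
HB.instance Definition _ := [SubChoice_isSubLmodule of qsym by <:].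

Lemma qseries_sum I (r : seq I) (P : pred I) (f : I -> qsym) :
  qseries (\sum_(i <- r | P i) f i) = \sum_(i <- r | P i) qseries (f i).
Proof. exact: (raddf_sum (val : qsym -> series)). Qed.

Lemma qseriesZ k (f : qsym) : qseries (k *: f) = k *: qseries f.
Proof. by []. Qed.

Lemma Mseries_qsym n (a : composition n) : Mseries a \in qsym_pred.
Proof.
apply/asboolP; exists n.+1.
exists (fun m b => (cval b == cval a)%:R).
rewrite big_ord_recr /= big1 ?add0r => [|i _].
  rewrite (bigD1 a) //= eqxx scale1r big1 ?addr0 // => b.
  by rewrite -val_eqE /= => /negPf ->; rewrite scale0r.
apply: big1 => b _; case: eqP => [eq_ba|]; last by rewrite scale0r.
have /andP[_ /eqP sb] := compP b; have /andP[_ /eqP sa] := compP a.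
by have := ltn_ord i; rewrite -{1}sb eq_ba sa ltnn.
Qed.

Definition M n (a : composition n) : qsym := QSym (Mseries_qsym a).

Lemma qseriesM n (a : composition n) : qseries (M a) = Mseries a. Proof. by []. Qed.

Definition F n (a : composition n) : qsym :=
  \sum_(b : composition n | refines b a) M b.


Lemma refines_refl n (a : composition n) : refines a a.
Proof.
apply/asboolP; exists [seq [:: x] | x <- cval a]; split.
  by elim: (cval a) => //= x s ->.
by rewrite -map_comp map_id_in // => x _ /=; rewrite addn0.
Qed.

Lemma refines_size n (b a : composition n) :
  refines b a -> (size b <= size a)%N -> b = a.
Proof.
move=> /asboolP[bs [eb ea]]; have /andP[pa _] := compP a; move: pa.
move=> pa le_ba; apply: val_inj; move: pa le_ba; rewrite /= -{}eb -{}ea.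
elim: bs => //= t bs IH /andP[t0 pbs].
have szge : (size [seq sumn t0 | t0 <- bs] <= size (flatten bs))%N.
  elim: bs pbs {IH} => //= u bs IH /andP[u0 /IH]; rewrite size_cat.
  by case: u u0 => //= x u _ le; rewrite addSn ltnS (leq_trans le) ?leq_addl.
rewrite size_cat; case: t t0 => [|x [|y t]] //= _.
  by rewrite addSn add0n ltnS addn0 => /(IH pbs) ->.
by rewrite !addSn !ltnS => /leq_trans/(_ szge); rewrite ltnNge leq_addl.
Qed.

Definition monom (s : seq nat) : monomial :=
  [fsfun k in [fset i in iota 0 (size s)]%fset => nth 0%N s k].

Lemma monomE s k : monom s k = nth 0%N s k.
Proof.
rewrite fsfunE !inE mem_iota /= add0n.
by case: ltnP => // le; rewrite nth_default.
Qed.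

Definition mdeg (m : monomial) : nat := (\sum_(k <- finsupp m) m k)%N.

Lemma Mseries_deg n (a : composition n) m : Mseries a m != 0 -> mdeg m = n.
Proof.
rewrite /Mseries; case: asboolP => //= -[i [_ _ mE]] _.
have /andP[pa /eqP <-] := compP a.
rewrite /mdeg sumnE (big_nth 0%N) big_mkord.
under eq_bigr => k _ do rewrite mE.
rewrite (exchange_big_dep xpredT) //=; apply: eq_bigr => j _.
have jm : nth 0%N i j \in finsupp m.
  rewrite mem_finsupp mE -lt0n (bigD1 j) //= addn_gt0.
  by have /allP/(_ _ (mem_nth 0%N (ltn_ord j))) -> := pa.
rewrite (big_rem _ jm) /= eqxx big1_seq ?addn0 // => k /andP[/eqP <-].
by rewrite mem_rem_uniqF ?fset_uniq.
Qed.

Lemma Mseries_monom n p (a : composition n) (b : composition p) :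
  Mseries a (monom b) = (cval a == cval b)%:R.
Proof.
rewrite /Mseries; congr (_ %:R); congr nat_of_bool.
have /andP[pa _] := compP a; have /andP[pb _] := compP b.
move: (cval a) (cval b) pa pb => {}a {}b pa pb.
apply/asboolP/eqP => [[i [si szi bE]]|->]; last first.
  exists (iota 0 (size b)); split; rewrite ?iota_ltn_sorted ?size_iota // => k.
  rewrite monomE; under eq_bigl => j do rewrite nth_iota //= add0n.
  case: (ltnP k (size b)) => [lt_k|ge_k].
    by rewrite (big_pred1 (Ordinal lt_k)) // => j /=; rewrite -val_eqE.
  rewrite nth_default // big_pred0 // => j; apply/negbTE.
  by rewrite neq_ltn (leq_trans (ltn_ord j)).
have ui : uniq i by apply: sorted_uniq si; [exact: ltn_trans | exact: ltnn].
have bi (j : 'I_(size a)) : nth 0%N b (nth 0%N i j) = nth 0%N a j.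
  rewrite -monomE bE (big_pred1 j) // => k /=.
  by rewrite nth_uniq ?szi // val_eqE.
have mi k : (k \in i) = (k < size b)%N.
  apply/idP/idP => [ki|lt_k].
    have ltj : (index k i < size a)%N by rewrite -szi index_mem.
    have := bi (Ordinal ltj); rewrite /= nth_index // => bk.
    rewrite ltnNge; apply/negP => ge_k; move: bk; rewrite nth_default //.
    by move/esym => a0; have /allP/(_ _ (mem_nth 0%N ltj)) := pa; rewrite a0.
  apply/negPn/negP => nki; have := bE k; rewrite monomE big_pred0.
    by move=> b0; have /allP/(_ _ (mem_nth 0%N lt_k)) := pb; rewrite b0.
  move=> j; apply/negbTE; apply: contra nki => /eqP <-.
  by rewrite mem_nth // szi.
have ei : i = iota 0 (size b).
  apply: (irr_sorted_eq ltn_trans ltnn) => //; first exact: iota_ltn_sorted.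
  by move=> k; rewrite mi mem_iota.
have sab : size a = size b by rewrite -szi ei size_iota.
apply: (@eq_from_nth _ 0%N) => // k lt_k.
by rewrite -(bi (Ordinal lt_k)) ei /= nth_iota // -sab.
Qed.

Lemma M_span_F n (a : composition n) :
  exists c : {ffun composition n -> int}, M a = \sum_b c b *: F b.
Proof.
have [k] := ubnP (n - size a); elim: k a => // k IHk a; rewrite ltnS => le_k.
have Ma : M a = F a - \sum_(b : composition n | refines b a && (b != a)) M b.
  by rewrite /F (bigD1 a) ?refines_refl //= addrK.
have /choice[c cE] : forall b, exists c : {ffun composition n -> int},
    refines b a && (b != a) -> M b = \sum_d c d *: F d.
  move=> b; case: (boolP (refines b a && (b != a))) => [/andP[rba neq]|]; last first.
    by exists 0.
  have lt_ab : (size a < size b)%N.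
    by rewrite ltnNge; apply: contra neq => /(refines_size rba) ->.
  have [|c cE] := IHk b; last by exists c.
  by apply: leq_trans le_k; rewrite ltn_sub2l // (leq_trans lt_ab) ?comp_size.
exists [ffun d => (d == a)%:R -
           \sum_(b : composition n | refines b a && (b != a)) c b d].
rewrite {1}Ma; under [RHS]eq_bigr => d _ do rewrite ffunE scalerBl scaler_suml.
rewrite sumrB; congr (_ - _); last first.
  by rewrite exchange_big; apply: eq_bigr => b /cE.
rewrite (bigD1 a) //= eqxx scale1r big1 ?addr0 // => d /negPf ->.
by rewrite scale0r.
Qed.

Lemma M_free n (c d : composition n -> int) :
  \sum_a c a *: M a = \sum_a d a *: M a -> c =1 d.
Proof.
have ev (e : composition n -> int) (a : composition n) : qseries (\sum_a e a *: M a) (monom a) = e a.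
  rewrite qseries_sum fct_sumE (bigD1 a) // qseriesZ scalrfctE.
  rewrite qseriesM Mseries_monom eqxx big1 ?addr0 => [|b ba].
    exact: etrans (addr0 _) (mulr1 _).
  by rewrite qseriesZ scalrfctE qseriesM Mseries_monom val_eqE (negPf ba) scaler0.
by move=> eq a; rewrite -(ev c) eq ev.
Qed.

Lemma F_dual n (P : composition n -> {ffun composition n -> int}) :
  (forall a, M a = \sum_b P a b *: F b) ->
  forall a d : composition n, \sum_(b : composition n | refines b a) P b d = (a == d)%:R.
Proof.
move=> PE a d.
pose mxP := \matrix_(i < #|{: composition n}|, j < #|{: composition n}|)
  P (enum_val i) (enum_val j).
pose mxZ := \matrix_(i < #|{: composition n}|, j < #|{: composition n}|)
  ((refines (enum_val j : composition n) (enum_val i))%:R : int).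
have PZ : mxP *m mxZ = 1%:M.
  apply/matrixP => i j; rewrite !mxE; set x := enum_val i; set y := enum_val j.
  have : \sum_e (x == e)%:R *: M e = \sum_e (\sum_b P x b * (refines e b)%:R) *: M e.
    transitivity (M x).
      rewrite (bigD1 x) //= eqxx scale1r big1 ?addr0 // => e.
      by rewrite eq_sym => /negPf ->; rewrite scale0r.
    rewrite PE; under [RHS]eq_bigr => e _ do rewrite scaler_suml.
    rewrite exchange_big; apply: eq_bigr => b _; rewrite /F scaler_sumr big_mkcond.
    apply: eq_bigr => e _; case: (refines e b); first by rewrite mulr1.
    by rewrite mulr0 scale0r.
  move/M_free/(_ y); rewrite (inj_eq enum_val_inj) => ->.
  rewrite [RHS](reindex _ (onW_bij _ (enum_val_bij _))); apply: eq_bigr => k _; by rewrite !mxE.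
have /matrixP/(_ (enum_rank a) (enum_rank d)) := mulmx1C PZ.
rewrite !mxE (inj_eq enum_rank_inj) => <-; rewrite big_mkcond [LHS](reindex _ (onW_bij _ (enum_val_bij _))).
apply: eq_bigr => k _; rewrite !mxE !enum_rankK.
by case: ifP; rewrite ?mul1r ?mul0r.
Qed.

Definition Fcoef n (a : composition n) : {ffun composition n -> int} :=
  sval (cid (M_span_F a)).

(* psi is characterized by its linearity and lemma psiF; it is obtained here by
   writing each M a in the basis F. The coefficient of M a in a quasisymmetric
   function f is f (monom a), and only degree mdeg m contributes to m. *)
Definition psiM n (a : composition n) : qsym := \sum_b Fcoef a b *: F (compl b).

Definition psi_series (f : series) : series := fun m =>
  \sum_(a : composition (mdeg m)) f (monom a) *: qseries (psiM a) m.

Lemma psi_series_linear : linear psi_series.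
Proof.
move=> k f g; apply/funext => m.
transitivity (k *: psi_series f m + psi_series g m); last by [].
rewrite /psi_series scaler_sumr -big_split; apply: eq_bigr => a _ /=.
by rewrite [(_ + _) _]/(k *: f (monom a) + g (monom a)) scalerDl scalerA.
Qed.

HB.instance Definition _ :=
  GRing.isLinear.Build int series series _ psi_series psi_series_linear.

Lemma psiM_deg n (a : composition n) m : qseries (psiM a) m != 0 -> mdeg m = n.
Proof.
apply: contra_neq_eq => neq; rewrite /psiM qseries_sum.
rewrite fct_sumE big1 // => b _; rewrite qseriesZ /F qseries_sum.
rewrite scalrfctE fct_sumE big1 ?scaler0 // => d _.
by apply/eqP; apply: contraNT neq => /Mseries_deg ->.
Qed.

Lemma psi_seriesM n (a : composition n) : psi_series (Mseries a) = psiM a.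
Proof.
apply/funext => m; rewrite /psi_series.
have [eq_m|neq_m] := eqVneq (mdeg m) n.
  case: n / eq_m a => a; rewrite (bigD1 a) //= Mseries_monom eqxx scale1r.
  rewrite big1 ?addr0 // => b; rewrite eq_sym => /negPf neq.
  by rewrite Mseries_monom val_eqE neq scale0r.
rewrite big1 => [|b _].
  by apply/esym/eqP; apply: contraNT neq_m => /psiM_deg ->.
rewrite Mseries_monom; case: eqP => [eq_ab|]; last by rewrite scale0r.
have /andP[_ /eqP sb] := compP b; have /andP[_ /eqP sa] := compP a.
by case/eqP: neq_m; rewrite -sb -eq_ab sa.
Qed.

Lemma psi_qsym (f : qsym) : psi_series f \in qsym_pred.
Proof.
case: f => f /= /asboolP[N [c ->]]; rewrite raddf_sum.
apply: rpred_sum => n _; rewrite raddf_sum; apply: rpred_sum => a _.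
by rewrite /= linearZ /= psi_seriesM rpredZ // qsymP.
Qed.

Definition psi (f : qsym) : qsym := QSym (psi_qsym f).

Lemma psi_linear : linear psi.
Proof. by move=> k f g; apply: val_inj; rewrite /= linearP. Qed.

HB.instance Definition _ := GRing.isLinear.Build int qsym qsym _ psi psi_linear.

Lemma psiF n (a : composition n) : psi (F a) = F (compl a).
Proof.
have psiME (b : composition n) : psi (M b) = psiM b.
  by apply: val_inj; rewrite /= psi_seriesM.
rewrite {1}/F raddf_sum; under eq_bigr => b _ do rewrite /= psiME /psiM.
rewrite exchange_big /=.
under eq_bigr => d _ do rewrite -scaler_suml (F_dual (fun e => svalP (cid (M_span_F e)))).
rewrite (bigD1 a) //= eqxx scale1r big1 ?addr0 // => d.
by rewrite eq_sym => /negPf ->; rewrite scale0r.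
Qed.

(* A filling is given by the list of its rows, from bottom to top. *)

Definition filling (a : seq nat) (T : seq (seq nat)) : bool :=
  (shape T == a) && all (all (leq 1)) T.

Definition first_column (T : seq (seq nat)) : seq nat :=
  [seq head 0%N r | r <- T].

Definition content (T : seq (seq nat)) (b : seq nat) : Prop :=
  forall i : nat, count_mem i.+1 (flatten T) = nth 0%N b i.

Definition immaculate (a : seq nat) (T : seq (seq nat)) : bool :=
  [&& filling a T, sorted ltn (first_column T) & all (sorted leq) T].

Definition row_strict_immaculate (a : seq nat) (T : seq (seq nat)) : bool :=
  [&& filling a T, sorted leq (first_column T) & all (sorted ltn) T].

Definition immaculate_set n (a b : composition n) : set (seq (seq nat)) :=
  [set T | immaculate a T /\ content T b]%classic.

Lemma immaculate_set_finite n (a b : composition n) : finite_set (immaculate_set a b).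
Proof.
apply: (@sub_finite_set _ _
  [set` [seq reshape a (map val w) | w : n.-tuple 'I_n.+1]]%classic); last first.
  by apply/finite_seqP; eexists.
move=> T [/and3P[/andP[/eqP sT pT] _ _] cT] /=.
have sw : size [seq inord i : 'I_n.+1 | i <- flatten T] == n.
  by rewrite size_map size_flatten sT; have /andP[] := compP a.
apply/mapP; exists (Tuple sw); rewrite ?mem_enum //=.
rewrite -map_comp map_id_in -?sT ?flattenK // => x xT /=.
rewrite inordK // ltnS; case: x xT => // i iT.
rewrite (leq_trans _ (comp_size b)) // ltnNge; apply/negP => ge_i.
by have := cT i; rewrite nth_default // => /count_memPn; rewrite iT.
Qed.

(* fset_set has its intended meaning here by immaculate_set_finite. *)
Definition K n (a b : composition n) : nat :=
  #|` fset_set (immaculate_set a b)|%fset.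

Definition dual_immaculate n (a : composition n) : qsym :=
  \sum_(b : composition n) (K a b)%:R *: M b.

Definition expansion n (B : composition n -> qsym) (G : qsym)
    (c : {ffun composition n -> int}) : Prop :=
  G = \sum_(b : composition n) c b *: B b.

Definition leading_index n (c : {ffun composition n -> int})
    (b : composition n) : Prop :=
  c b <> 0 /\ forall d : composition n, c d <> 0 -> lexle d b.

Definition columns (a : seq nat) : seq nat :=
  [seq count (leq i) a | i <- iota 1 (\max_(x <- a) x)].

Lemma columns_subproof n (a : composition n) : is_comp n (columns a).
Proof.
have := compP a; rewrite /is_comp; move: (cval a) => {}a /andP[pa /eqP <-].
apply/andP; split.
  apply/allP => x /mapP[i]; rewrite mem_iota add1n ltnS => /andP[i0 le_i] ->.
  rewrite -has_count; apply: contraLR le_i => /hasPn nle; rewrite -ltnNge.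
  rewrite -(prednK i0) ltnS; apply/bigmax_leqP_seq => y ya _.
  by rewrite -ltnS prednK // ltnNge; apply: nle.
rewrite sumnE big_map; under eq_bigr => i _ do rewrite -sum1_count big_mkcond.
rewrite exchange_big /= sumnE big_seq [X in _ == X]big_seq; apply/eqP.
apply: eq_bigr => x xa; rewrite -big_mkcond sum1_count.
have le_x : (x <= \max_(y <- a) y)%N by rewrite (big_rem x xa) leq_maxl.
rewrite -(subnKC le_x) iotaD count_cat.
have /eqP -> : count (leq^~ x) (iota 1 x) == x.
  rewrite -[X in _ == X](size_iota 1) -all_count.
  by apply/allP => i; rewrite mem_iota add1n ltnS => /andP[].
rewrite (eq_in_count (a2 := pred0)) ?count_pred0 ?addn0 // => i.
by rewrite mem_iota add1n => /andP[lt_x _] /=; rewrite leqNgt lt_x.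
Qed.

Definition beta_psi n (a : composition n) : composition n :=
  Comp (columns_subproof a).

(* Main.v *)
Require Import Defs.
From mathcomp Require Import all_boot all_order all_algebra finmap.
From mathcomp Require Import boolp classical_sets cardinality.

Set Implicit Arguments.
Unset Strict Implicit.
Unset Printing Implicit Defensive.

Import GRing.Theory.

(** A tableau with entries x in rows r is a multiset of pairs (x, r), and a
    multiset of pairs is the same as a sorted biword: the entries in weakly
    increasing order on top, the rows below, where pairs with equal entries are
    ordered by a chosen total order R on the rows.  For a fixed content the top
    line is known, so the bottom line, a rearrangement w of the row numbers,
    determines the tableau ([rows_tableau_word], [tableau_wordK]).

    With R decreasing, the strict condition on the first column of an
    immaculate tableau says that the rows make their first appearances in w in
    the order 0, 1, 2, ...; with R increasing, the weak condition of the
    row-strict case says exactly the same ([rows_first_column]).  Hence both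
    kinds of tableaux of shape a live in one set [words a]: content b
    requires w to be weakly decreasing inside the blocks cut out by b in the
    first case, strictly increasing in the second.  The first case says that
    the ascents of w lie in Set(b), so the dual immaculate function of a is the
    sum over [words a] of F indexed by the ascent set ([dual_immaculate_F]).
    The complement of Set, hence psi, exchanges ascents and weak descents, so
    psi of it is the generating function of the second case
    ([psi_dual_immaculate]): its coefficient at M_b counts the row-strict
    tableaux of shape a and content b.

    The leading terms come from minimal fillings.  Every entry of row r
    (counted from 1) of an immaculate tableau is at least r, every entry of
    column j of a row-strict tableau is at least j.  If a tableau dominates a
    filling T0 cell by cell, then it has at most as many entries <= i as T0,
    for each i; so its content is lexicographically at most that of T0, and
    the tableau equals T0 when the contents agree ([dominated_content]).  In
    the first case T0 has content a, so the matrix K is lexicographically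
    unitriangular ([K_neq0], [K_diag]), and passing from the basis M to the
    dual immaculate functions preserves leading terms with coefficient 1
    ([triangular_leading]).  In the second case T0 is the tableau whose column
    i is filled with i; its content is the sequence of column lengths, which
    settles both halves of the theorem. *)

(** * Partial sums and refinement *)

(** The set of a composition together with the two trivial sums 0 and n, which
    make it behave uniformly under concatenation. *)
Definition psums (s : seq nat) : seq nat :=
  [seq sumn (take k s) | k <- iota 0 (size s).+1].

Lemma psums_cons x s : psums (x :: s) = 0 :: map (addn x) (psums s).
Proof.
rewrite /psums -map_comp -[iota _ (size (x :: s)).+1]/(0 :: iota (1 + 0) (size s).+1).
by rewrite iotaDl map_cons -map_comp.
Qed.

Lemma mem0_psums s : 0 \in psums s.
Proof. by case: s => [|x s]; rewrite ?psums_cons inE. Qed.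

Lemma mem_psums_cons x s k :
  (k \in psums (x :: s)) = (k == 0) || (x <= k) && (k - x \in psums s).
Proof.
rewrite psums_cons inE; congr (_ || _); apply/mapP/andP => [[j sj ->]|[le_xk sk]].
  by rewrite leq_addr addKn.
by exists (k - x); rewrite ?subnKC.
Qed.

Lemma mem_psums_cat s t k : (k \in psums (s ++ t)) =
  (k \in psums s) || (sumn s <= k) && (k - sumn s \in psums t).
Proof.
elim: s k => [|x s IHs] k /=.
  by rewrite subn0 mem_seq1; case: eqP => [->|_] //=; rewrite mem0_psums.
rewrite !mem_psums_cons IHs -orbA; congr (_ || _).
case: leqP => [le_xk|lt_kx] /=; first by rewrite subnDA leq_subRL.
by rewrite leqNgt ltn_addr.
Qed.

Lemma psums_le s k : k \in psums s -> k <= sumn s.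
Proof.
case/mapP=> j _ ->; rewrite -{2}(cat_take_drop j s) sumn_cat; exact: leq_addr.
Qed.

Lemma psums_split s k :
  k \in psums s -> exists s1 s2, s = s1 ++ s2 /\ sumn s1 = k.
Proof. by case/mapP=> j _ ->; exists (take j s), (drop j s); rewrite cat_take_drop. Qed.

Lemma mem_comp_set s k : 0 < k < sumn s -> (k \in comp_set s) = (k \in psums s).
Proof.
case/andP=> k_gt0 lt_ks; apply/mapP/mapP => -[j]; rewrite mem_iota.
  rewrite add1n => /andP[_ lt_j] k_def; exists j => //; rewrite mem_iota.
  by apply: leq_trans lt_j _; rewrite ltnS leq_pred.
rewrite add0n ltnS => /= le_j k_def; exists j => //; rewrite mem_iota add1n.
have j_gt0 : 0 < j.
  by case: j {le_j} k_def => // k0; rewrite k0 take0 in k_gt0.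
have j_lt : j < size s.
  by rewrite ltnNge; apply/negP=> ge_j; rewrite k_def take_oversize // ltnn in lt_ks.
by rewrite j_gt0 prednK // (leq_ltn_trans _ j_lt).
Qed.

(** This is what makes Set(Comp(S)) equal to S. *)
Lemma psums_pairmap k l : path ltn k l ->
  map (addn k) (psums (pairmap (fun a b => b - a) k l)) = k :: l.
Proof.
elim: l k => [|x l IHl] k; first by rewrite /psums /= addn0.
case/andP=> lt_kx pl; rewrite [pairmap _ _ _]/= psums_cons map_cons addn0.
rewrite -map_comp; congr (_ :: _).
rewrite -(IHl x pl); apply: eq_map => y /=; rewrite addnA subnKC //; exact: ltnW.
Qed.

Lemma mem_psums_Comp_of_set n S k : 0 < k < n ->
  (k \in psums (Comp_of_set n S)) = (k \in S).
Proof.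
case/andP=> k_gt0 lt_kn; rewrite /Comp_of_set /= /set_comp; set l := filter _ _.
have pl : path ltn 0 l.
  apply: (subseq_path ltn_trans) (filter_subseq _ _) _.
  by rewrite -[path _ _ _]/(sorted ltn (iota 0 n.+1)) iota_ltn_sorted.
rewrite -[psums _]map_id (psums_pairmap pl) inE mem_filter mem_iota add1n ltnS.
by rewrite eqn0Ngt k_gt0 (ltnW lt_kn) (ltn_eqF lt_kn) !orbF !andbT.
Qed.

Lemma psums_sumn s : sumn s \in psums s.
Proof.
apply/mapP; exists (size s); rewrite ?take_size // mem_iota; exact: ltnSn.
Qed.

Lemma psums_flatten (bs : seq (seq nat)) :
  {subset psums (map sumn bs) <= psums (flatten bs)}.
Proof.
elim: bs => //= t bs IHbs k; rewrite mem_psums_cons mem_psums_cat.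
by case/orP=> [/eqP->|/andP[-> /IHbs->]]; rewrite ?mem0_psums ?orbT.
Qed.

(** The first part x of a is a partial sum of b, so it is the sum of a prefix of
    b, which is the first block; what remains of a and b satisfies the same
    hypotheses. *)
Lemma psums_blocks (a b : seq nat) :
  all (leq 1) a -> all (leq 1) b -> sumn a = sumn b ->
  {subset psums a <= psums b} ->
  exists bs : seq (seq nat), flatten bs = b /\ map sumn bs = a.
Proof.
elim: a b => [|x a IHa] b /=.
  move=> _ pb sb _; exists [::]; case: b pb sb => //= y b /andP[y_gt0 _].
  by move/esym/eqP; rewrite addn_eq0 eqn0Ngt y_gt0.
case/andP=> x_gt0 pa pb sab sub_ab.
have /psums_split[s [t [b_def sx]]] : x \in psums b.
  by apply: sub_ab; rewrite mem_psums_cons leqnn subnn mem0_psums orbT.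
move: pb sab sub_ab; rewrite b_def all_cat sumn_cat sx => /andP[ps pt] /addnI sat sub.
have [|bs [<- <-]] := IHa t pa pt sat; last by exists (s :: bs); rewrite /= sx.
move=> y ay; have : x + y \in psums (s ++ t).
  by apply: sub; rewrite mem_psums_cons leq_addr addKn ay orbT.
rewrite mem_psums_cat sx leq_addr addKn; case/orP=> // /psums_le.
by rewrite sx -{2}[x]addn0 leq_add2l leqn0 => /eqP->; apply: mem0_psums.
Qed.

(** Reverse inclusion of sets, in the form in which refinement is used below:
    the trivial sums 0 and n are common to all compositions of n. *)
Lemma refinesP n (b a : composition n) :
  reflect (forall k, 0 < k < n -> k \in psums a -> k \in psums b) (refines b a).
Proof.
have /andP[pa /eqP sa] := compP a; have /andP[pb /eqP sb] := compP b.
apply: (iffP (asboolP _)) => [[bs [<- <-]] k _ /psums_flatten //|sub].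
apply: psums_blocks; rewrite ?sa ?sb // => k ka.
have [k0|k_gt0] := posnP k; first by rewrite k0 mem0_psums.
have := psums_le ka; rewrite sa leq_eqVlt => /orP[/eqP->|lt_kn].
  by rewrite -{1}sb psums_sumn.
by apply: sub; rewrite ?k_gt0.
Qed.

Lemma mem_psums_compl n (a : composition n) k : 0 < k < n ->
  (k \in psums (compl a)) = (k \notin psums a).
Proof.
move=> k_n; have /andP[_ /eqP sa] := compP a; rewrite mem_psums_Comp_of_set //.
rewrite mem_filter mem_iota mem_comp_set ?sa // add1n.
by case/andP: k_n => k_gt0 lt_kn; rewrite k_gt0 prednK ?lt_kn ?andbT // (leq_trans _ lt_kn).
Qed.

(** * Sorted biwords *)

(** The weakly increasing sequence of content b over the alphabet i, i + 1, ... *)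
Fixpoint labels (i : nat) (b : seq nat) : seq nat :=
  if b is x :: b' then nseq x i ++ labels i.+1 b' else [::].

Lemma size_labels i b : size (labels i b) = sumn b.
Proof. by elim: b i => //= x b IHb i; rewrite size_cat size_nseq IHb. Qed.

Lemma labels_ge i b : all (leq i) (labels i b).
Proof.
elim: b i => //= x b IHb i; rewrite all_cat all_nseq leqnn orbT /=.
by apply: sub_all (IHb i.+1) => j /ltnW.
Qed.

Lemma sorted_nseq x i : sorted leq (nseq x i).
Proof. by case: x => //= x; elim: x => //= x ->; rewrite leqnn. Qed.

Lemma count0_pos s : all (leq 1) s -> count_mem 0 s = 0.
Proof. by move=> ps; apply/count_memPn/negP => /(allP ps). Qed.

Lemma perm_content s t : all (leq 1) s -> all (leq 1) t ->
  (forall i, count_mem i.+1 s = count_mem i.+1 t) -> perm_eq s t.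
Proof.
by move=> ps pt cnt; apply/allP => -[|i] _ /=; rewrite ?count0_pos ?cnt.
Qed.

Lemma sorted_labels i b : sorted leq (labels i b).
Proof.
elim: b i => //= x b IHb i; rewrite sorted_pairwise; last exact: leq_trans.
rewrite pairwise_cat -!sorted_pairwise ?IHb ?andbT; try exact: leq_trans.
apply/andP; split.
  apply/allrelP => y z /nseqP[-> _] zb; apply: ltnW.
  exact: (allP (labels_ge _ _)) z zb.
exact: sorted_nseq.
Qed.

Lemma count_labels i b j : count_mem (i + j) (labels i b) = nth 0 b j.
Proof.
elim: b i j => [|x b IHb] i j /=; first by rewrite nth_nil.
rewrite count_cat count_nseq /=; case: j => [|j]; last first.
  by rewrite -{1}[i]addn0 eqn_add2l mul0n addnS -addSn IHb.
rewrite addn0 eqxx mul1n (count_memPn _) ?addn0 //.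
by apply/negP=> /(allP (labels_ge i.+1 b)); rewrite ltnn.
Qed.

Lemma labels_uniq (s b : seq nat) :
  sorted leq s -> all (leq 1) s -> (forall i, count_mem i.+1 s = nth 0 b i) ->
  s = labels 1 b.
Proof.
move=> srt pos cnt; apply: (sorted_eq leq_trans anti_leq) => //.
  exact: sorted_labels.
by apply: perm_content => // [|i]; rewrite ?labels_ge // cnt -add1n count_labels.
Qed.

Lemma labels_jump i b k : all (leq 1) b -> k.+1 < sumn b ->
  (nth 0 (labels i b) k < nth 0 (labels i b) k.+1) = (k.+1 \in psums b).
Proof.
elim: b i k => [|x b IHb] i k //= /andP[x_gt0 pb] lt_k.
rewrite mem_psums_cons /= !nth_cat size_nseq.
case: (ltngtP k.+1 x) => [lt_kx|gt_kx|k_x].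
- by rewrite !nth_nseq lt_kx (ltnW lt_kx) ltnn.
- by rewrite subSn // IHb // -subSn // ltn_subLR // ltnW.
rewrite -k_x nth_nseq ltnSn subnn mem0_psums.
case: b pb lt_k {IHb} => [|y b] /=; first by rewrite k_x addn0 ltnn.
by case/andP=> y_gt0 _ _; rewrite nth_cat size_nseq y_gt0 nth_nseq y_gt0 ltnSn.
Qed.

(** The order of biwords; R is the order of the rows that carry equal entries. *)
Definition lex_le (R : rel nat) : rel (nat * nat) :=
  fun p q => (p.1 < q.1) || (p.1 == q.1) && R p.2 q.2.

Lemma lex_le_trans R : transitive R -> transitive (lex_le R).
Proof.
move=> trR [y1 y2] [x1 x2] [z1 z2]; rewrite /lex_le /=.
case/orP=> [xy|/andP[/eqP-> xy]]; case/orP=> [yz|/andP[/eqP<- yz]].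
- by rewrite (ltn_trans xy yz).
- by rewrite xy.
- by rewrite yz.
- by rewrite eqxx (trR _ _ _ xy yz) orbT.
Qed.

Lemma lex_le_total R : total R -> total (lex_le R).
Proof.
move=> totR [x1 x2] [y1 y2]; rewrite /lex_le /=.
by case: ltngtP => //= _; apply: totR.
Qed.

Lemma lex_le_anti R : antisymmetric R -> antisymmetric (lex_le R).
Proof.
move=> antiR [x1 x2] [y1 y2]; rewrite /lex_le /=.
by case: ltngtP => //= -> /antiR ->.
Qed.

(** Consecutive pairs with different labels are always in order, and the label
    changes exactly at the partial sums of b; elsewhere R decides. *)
Lemma sorted_biword R b w : all (leq 1) b -> size w = sumn b ->
  sorted (lex_le R) (zip (labels 1 b) w) =
  all (fun k => R (nth 0 w k.-1) (nth 0 w k) || (k \in psums b))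
    (iota 1 (sumn b).-1).
Proof.
move=> pb sw; have sl : size (labels 1 b) = size w by rewrite size_labels sw.
have lexE k : k.+1 < sumn b ->
    lex_le R (nth (0, 0) (zip (labels 1 b) w) k) (nth (0, 0) (zip (labels 1 b) w) k.+1)
    = R (nth 0 w k) (nth 0 w k.+1) || (k.+1 \in psums b).
  move=> lt_k; rewrite !nth_zip // /lex_le /= labels_jump // orbC eqn_leq.
  have ->/= : nth 0 (labels 1 b) k <= nth 0 (labels 1 b) k.+1.
    by have /sortedP := sorted_labels 1 b; apply; rewrite size_labels.
  by rewrite [_ <= nth 0 _ k]leqNgt labels_jump //; case: (_ \in _); rewrite /= ?orbT.
apply/(sortedP (0, 0))/allP => [srt [|k]|cond k].
- by rewrite mem_iota.
- rewrite mem_iota add1n !ltnS ltn_predRL /= => lt_k.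
  by rewrite -lexE // srt // size_zip sl minnn sw.
rewrite size_zip sl minnn sw => lt_k; rewrite lexE //; apply: (cond k.+1).
by rewrite mem_iota add1n !ltnS ltn_predRL.
Qed.

(** * Tableaux and words *)

(** The pair (x, r) stands for an entry x in row r, rows being numbered from 0. *)
Definition cells (T : seq (seq nat)) : seq (nat * nat) :=
  [seq (x, r) | r <- iota 0 (size T), x <- nth [::] T r].

(** The bottom lines of the biwords of the tableaux of shape a are rearrangements
    of this word. *)
Definition row_word (a : seq nat) : seq nat :=
  flatten [seq nseq (nth 0 a r) r | r <- iota 0 (size a)].

(** Inverse to cells, up to the order in which z lists the cells. *)
Definition rows (l : nat) (z : seq (nat * nat)) : seq (seq nat) :=
  [seq unzip1 [seq p <- z | p.2 == r] | r <- iota 0 l].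

Lemma unzip1_cells T : unzip1 (cells T) = flatten T.
Proof.
rewrite /unzip1 /cells map_flatten -map_comp; congr flatten.
rewrite -[RHS](mkseq_nth [::]); apply: eq_map => r /=.
by rewrite -map_comp map_id.
Qed.

Lemma unzip2_cells T : unzip2 (cells T) = row_word (shape T).
Proof.
rewrite /unzip2 /cells map_flatten -map_comp /row_word size_map; congr flatten.
apply/eq_in_map => r; rewrite mem_iota => /= lt_r.
rewrite (nth_map [::]) // -map_comp.
by elim: (nth _ T r) => //= x s ->.
Qed.

Lemma filter_cells T r : r < size T ->
  unzip1 [seq p <- cells T | p.2 == r] = nth [::] T r.
Proof.
move=> lt_r; have filterE (I : seq nat) : uniq I ->
    unzip1 [seq p <- [seq (x, i) | i <- I, x <- nth [::] T i] | p.2 == r] =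
    if r \in I then nth [::] T r else [::].
  elim: I => //= i I IHI /andP[i_notin uI].
  rewrite filter_cat /unzip1 map_cat -/(unzip1 _) [X in _ ++ X]IHI // inE eq_sym.
  rewrite filter_map /unzip1 -map_comp; case: eqP => [<-|ne_ir] /=.
    rewrite (negPf i_notin) cats0 (eq_filter (a2 := predT)) => [|x /=].
      by rewrite filter_predT map_id.
    by rewrite eqxx.
  by rewrite (eq_filter (a2 := pred0)) ?filter_pred0 // => x /=; apply/eqP.
by rewrite filterE ?iota_uniq // mem_iota lt_r.
Qed.

Lemma perm_cells_rows l z : all (fun p => p.2 < l) z -> perm_eq (cells (rows l z)) z.
Proof.
move=> lt_zl; have -> : cells (rows l z) = flatten [seq [seq p <- z | p.2 == r] | r <- iota 0 l].
  rewrite /cells size_map size_iota; congr flatten; apply/eq_in_map => r.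
  rewrite mem_iota => /= lt_r; rewrite (nth_map 0) ?size_iota // nth_iota //.
  rewrite -map_comp -[RHS]map_id; apply/eq_in_map => -[x y] /=.
  by rewrite mem_filter /= => /andP[/eqP->].
have /all_filterP {2}<- := lt_zl; elim: l {lt_zl} => [|l IHl].
  by rewrite /= (eq_filter (a2 := pred0)) ?filter_pred0.
rewrite -[l.+1]addn1 iotaD map_cat flatten_cat /= cats0.
rewrite perm_sym -(perm_filterC (fun p => p.2 == l)) -!filter_predI add0n.
rewrite perm_catC perm_sym; apply: perm_cat.
  rewrite (eq_filter (a2 := fun p : nat * nat => p.2 < l)) // => p /=.
  by rewrite addn1 ltnS [in RHS]ltn_neqAle.
rewrite [X in perm_eq _ X](eq_filter (a2 := fun p : nat * nat => p.2 == l)) // => p /=.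
by case: eqP => //= ->; rewrite addn1 ltnSn.
Qed.

Lemma all_flatten (P : pred nat) (T : seq (seq nat)) :
  all P (flatten T) = all (all P) T.
Proof. by elim: T => //= t T IHT; rewrite all_cat IHT. Qed.

(** Restricted growth: 0, 1, ..., l - 1 make their first appearances in this
    order. *)
Definition rgf (l : nat) (w : seq nat) : bool :=
  sorted ltn [seq index r w | r <- iota 0 l].

(** These words encode the standard immaculate tableaux of shape a, in which each
    of the entries 1, ..., n occurs once: the k-th letter is the row of k. *)
Definition words (a : seq nat) : seq (seq nat) :=
  [seq w <- permutations (row_word a) | rgf (size a) w].

Definition biword (b w : seq nat) : seq (nat * nat) := zip (labels 1 b) w.

Definition tableau_word (R : rel nat) (T : seq (seq nat)) : seq nat :=
  unzip2 (sort (lex_le R) (cells T)).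

Lemma size_row_word a : size (row_word a) = sumn a.
Proof.
rewrite size_flatten /shape -map_comp; congr sumn.
by rewrite -[RHS](mkseq_nth 0); apply: eq_map => r /=; rewrite size_nseq.
Qed.

Lemma count_row_word a r : count_mem r (row_word a) = nth 0 a r.
Proof.
rewrite count_flatten -map_comp; have [lt_r|ge_r] := ltnP r (size a); last first.
  rewrite nth_default //; apply/eqP; rewrite sumnE big_map big1_seq // => i.
  rewrite mem_iota /= => lt_i; rewrite count_nseq /=.
  by case: eqP => // ri; rewrite ri ltnNge ge_r in lt_i.
rewrite sumnE big_map (bigD1_seq r) ?iota_uniq ?mem_iota //=.
rewrite big1_seq ?addn0 => [|i /andP[ne_ir _]]; rewrite count_nseq /= ?eqxx ?mul1n //.
by rewrite (negPf ne_ir).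
Qed.

Lemma row_word_lt a : all (gtn (size a)) (row_word a).
Proof.
apply/allP => x /flattenP[s /mapP[r]]; rewrite mem_iota => lt_r -> /nseqP[-> _].
exact: lt_r.
Qed.

Section TableauWord.
Variables (R : rel nat) (R_tr : transitive R) (R_total : total R).
Variable (R_anti : antisymmetric R).

(** The sorted entries of T are determined by the content of T. *)
Lemma sort_cells a b T : filling a T -> all (sorted leq) T -> content T b ->
  sort (lex_le R) (cells T) = biword b (tableau_word R T).
Proof.
case/andP=> /eqP shT posT rowsT contT; rewrite -[LHS]zip_unzip; congr zip.
have permT : perm_eq (unzip1 (sort (lex_le R) (cells T))) (flatten T).
  by rewrite -unzip1_cells; apply: perm_map; rewrite perm_sort.
apply: labels_uniq => [||i].
- apply: (homo_sorted (e := lex_le R)) (sort_sorted (lex_le_total R_total) _).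
  by move=> p q /orP[/ltnW|/andP[/eqP-> _]].
- by rewrite (perm_all _ permT) all_flatten.
by rewrite (permP permT) contT.
Qed.

(** Sorting the cells keeps each row in weakly increasing order, so the rows of
    the sorted biword are those of T. *)
Lemma rows_tableau_word a b T :
    filling a T -> all (sorted leq) T -> content T b ->
  rows (size a) (biword b (tableau_word R T)) = T.
Proof.
move=> fillT rowsT contT; rewrite -(sort_cells fillT) //.
have {fillT} <- : size T = size a by case/andP: fillT => /eqP<- _; rewrite size_map.
apply: (@eq_from_nth _ [::]); rewrite size_map size_iota // => r lt_r.
rewrite (nth_map 0) ?size_iota // nth_iota // add0n.
apply: (sorted_eq leq_trans anti_leq).
- apply: (homo_sorted (e := lex_le R)).
    by move=> p q /orP[/ltnW|/andP[/eqP-> _]].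
  exact/(sorted_filter (lex_le_trans R_tr))/(sort_sorted (lex_le_total R_total)).
- by apply: (allP rowsT); apply: mem_nth.
rewrite -filter_cells //; apply: perm_map; apply: perm_filter.
by rewrite perm_sort.
Qed.

Lemma tableau_wordK a b w : perm_eq w (row_word a) -> sumn a = sumn b ->
  sorted (lex_le R) (biword b w) ->
  tableau_word R (rows (size a) (biword b w)) = w.
Proof.
move=> permw sab srt; rewrite /tableau_word.
have sz : size (labels 1 b) = size w.
  by rewrite size_labels (perm_size permw) size_row_word.
have -> : sort (lex_le R) (cells (rows (size a) (biword b w))) = biword b w.
  apply: (sorted_eq (lex_le_trans R_tr) (lex_le_anti R_anti)) => //.
    exact: (sort_sorted (lex_le_total R_total)).
  rewrite perm_sort; apply: perm_cells_rows.
  have : all (gtn (size a)) (unzip2 (biword b w)).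
    by rewrite unzip2_zip ?sz // (perm_all _ permw) row_word_lt.
  by rewrite all_map.
by rewrite unzip2_zip // sz.
Qed.

Lemma perm_tableau_word a T : shape T = a -> perm_eq (tableau_word R T) (row_word a).
Proof. by move=> <-; rewrite -unzip2_cells; apply: perm_map; rewrite perm_sort. Qed.

(** Sortedness gives the order of the cells from that of their positions; the
    converse follows by antisymmetry, since the cells are distinct. *)
Lemma first_occurrences b w r s : size w = sumn b -> sorted (lex_le R) (biword b w) ->
    r \in w -> s \in w -> r != s ->
  lex_le R (nth 0 (labels 1 b) (index r w), r) (nth 0 (labels 1 b) (index s w), s)
  = (index r w < index s w).
Proof.
move=> sw srt rw sw' ne_rs; have sl : size (labels 1 b) = size w by rewrite size_labels.
have R_refl : reflexive (lex_le R) by move=> p; have := lex_le_total R_total p p; rewrite orbb.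
have nthE t : t \in w -> (nth 0 (labels 1 b) (index t w), t) = nth (0, 0) (biword b w) (index t w).
  by move=> tw; rewrite nth_zip // nth_index.
have szb : size (biword b w) = size w by rewrite size_zip sl minnn.
have mono u v : u \in w -> v \in w -> index u w <= index v w ->
    lex_le R (nth 0 (labels 1 b) (index u w), u) (nth 0 (labels 1 b) (index v w), v).
  move=> uw vw le_uv; rewrite !nthE //.
  by apply: (sorted_leq_nth (lex_le_trans R_tr) R_refl) => //; rewrite inE szb index_mem.
apply/idP/idP => [le_rs|/ltnW]; last exact: mono.
rewrite ltnNge; apply/negP => /(mono _ _ sw' rw) le_sr.
by have [_ /eqP] := lex_le_anti R_anti (introT andP (conj le_rs le_sr)); apply/negP.
Qed.

End TableauWord.

(** Rows inherit from the biword the order e that lex_le R induces on cells of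
    the same row: weakly increasing if R is reflexive, strictly increasing if R
    is irreflexive. *)
Lemma rowsP (R e : rel nat) a b w : transitive R ->
    (forall r x y, lex_le R (x, r) (y, r) -> e x y) ->
    perm_eq w (row_word a) -> sumn a = sumn b ->
  sorted (lex_le R) (biword b w) ->
  let T := rows (size a) (biword b w) in
  [/\ filling a T, all (sorted e) T & content T b].
Proof.
move=> R_tr Re permw sab srt T.
have sz : size (labels 1 b) = size w.
  by rewrite size_labels (perm_size permw) size_row_word.
have permT : perm_eq (flatten T) (labels 1 b).
  rewrite -unzip1_cells -[labels 1 b](@unzip1_zip _ _ _ w) ?sz //; apply: perm_map.
  apply: perm_cells_rows.
  have : all (gtn (size a)) (unzip2 (biword b w)).
    by rewrite unzip2_zip ?sz // (perm_all _ permw) row_word_lt.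
  by rewrite all_map.
split; last by move=> i; rewrite (permP permT) -add1n count_labels.
  rewrite /filling -all_flatten (perm_all _ permT) labels_ge andbT; apply/eqP.
  apply: (@eq_from_nth _ 0); rewrite ?size_map ?size_iota // => r lt_r.
  rewrite (nth_map [::]) ?size_map ?size_iota // (nth_map 0) ?size_iota //.
  rewrite nth_iota // add0n size_map size_filter -count_row_word -(permP permw).
  by rewrite -[in RHS](@unzip2_zip _ _ (labels 1 b) w) ?sz // count_map.
apply/allP => _ /mapP[r _ ->].
have /= := sorted_filter (lex_le_trans R_tr) (fun p => p.2 == r) srt.
rewrite sorted_map; apply: (@sub_in_sorted _ (fun p => p.2 == r)).
  by move=> [x1 x2] [y1 y2]; rewrite /= !unfold_in /= => /eqP-> /eqP->; apply: Re.
exact: filter_all.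
Qed.

(** A first column is sorted for e as soon as consecutive first cells are in the
    order of the biword.  For R decreasing, e is strict; for R increasing, e is
    weak; the condition on the word is the same. *)
Lemma rows_first_column (R e : rel nat) a b w : transitive R -> total R ->
    antisymmetric R -> (forall r x y, lex_le R (x, r) (y, r.+1) = e x y) ->
    all (leq 1) a -> perm_eq w (row_word a) -> sumn a = sumn b ->
    sorted (lex_le R) (biword b w) ->
  sorted e (first_column (rows (size a) (biword b w))) = rgf (size a) w.
Proof.
move=> R_tr R_total R_anti Re pa permw sab srt.
have sw : size w = sumn b by rewrite (perm_size permw) size_row_word.
have sz : size (labels 1 b) = size w by rewrite size_labels.
have mem_w r : r < size a -> r \in w.
  move=> lt_r; rewrite -has_pred1 has_count (permP permw) count_row_word.
  by apply: (allP pa); apply: mem_nth.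
have headE r : r \in w -> head 0 (unzip1 [seq p <- biword b w | p.2 == r]) =
    nth 0 (labels 1 b) (index r w).
  rewrite /biword; elim: (w) (labels 1 b) sz => // y v IHv [|x t] //= [st].
  by rewrite inE eq_sym; case: eqP => //= _ /(IHv t st) ->.
rewrite /rgf; apply/(sortedP 0)/(sortedP 0) => srt' r;
  have := srt' r; rewrite !size_map !size_iota => {srt'} + lt_r; move/(_ lt_r).
all: rewrite !(nth_map [::]) ?size_map ?size_iota ?(ltnW lt_r) //.
all: rewrite !(nth_map 0) ?size_iota ?(ltnW lt_r) //.
all: rewrite !nth_iota ?(ltnW lt_r) // !add0n !headE ?mem_w ?(ltnW lt_r) //.
all: rewrite -(Re r) (first_occurrences R_tr R_total R_anti) ?mem_w ?(ltnW lt_r) //.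
all: by rewrite neq_ltn ltnSn.
Qed.

Lemma lex_le_geq_next r x y : lex_le geq (x, r) (y, r.+1) = (x < y).
Proof. by rewrite /lex_le /= ltnn andbF orbF. Qed.

Lemma lex_le_leq_next r x y : lex_le leq (x, r) (y, r.+1) = (x <= y).
Proof. by rewrite /lex_le /= leqnSn andbT orbC -leq_eqVlt. Qed.

Lemma lex_le_geq_row r x y : lex_le geq (x, r) (y, r) -> x <= y.
Proof. by case/orP=> [/ltnW|/andP[/eqP /= -> _]]. Qed.

Lemma lex_le_ltn_row r x y : lex_le ltn (x, r) (y, r) -> x < y.
Proof. by rewrite /lex_le /= ltnn andbF orbF. Qed.

Lemma geq_trans : transitive geq.
Proof. by move=> y x z /= yx zy; apply: leq_trans zy yx. Qed.

Lemma geq_total : total geq.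
Proof. by move=> x y /=; apply: leq_total. Qed.

Lemma anti_geq : antisymmetric geq.
Proof. by move=> x y /=; rewrite andbC => /anti_leq. Qed.

Lemma comp_pos n (a : composition n) : all (leq 1) a.
Proof. by case/andP: (compP a). Qed.

Lemma comp_sumn n (a : composition n) : sumn a = n.
Proof. by case/andP: (compP a) => _ /eqP. Qed.

Lemma words_uniq a : uniq (words a).
Proof. by rewrite filter_uniq ?permutations_uniq. Qed.

(** The bijection between immaculate tableaux and words, the rows with equal
    entries being read downwards so that the strict first column becomes
    restricted growth. *)
Lemma K_words n (a b : composition n) :
  K a b = count (fun w => sorted (lex_le geq) (biword b w)) (words a).
Proof.
pose f w := rows (size a) (biword b w).
pose W := [seq w <- words a | sorted (lex_le geq) (biword b w)].
have inW w : w \in W -> [/\ perm_eq w (row_word a), rgf (size a) w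
    & sorted (lex_le geq) (biword b w)].
  by rewrite !mem_filter mem_permutations => /and3P[].
have sab : sumn a = sumn b by rewrite !comp_sumn.
have f_inj : {in W &, injective f}.
  apply: (can_in_inj (g := tableau_word geq)) => w /inW[permw _ srt].
  exact: (tableau_wordK geq_trans geq_total anti_geq permw sab srt).
rewrite /K -size_filter -/W -(size_map f).
have -> : fset_set (immaculate_set a b) = [fset T in map f W]%fset.
  apply/fsetP => T; rewrite in_fset_set ?in_fset; last exact: immaculate_set_finite.
  apply/idP/mapP => [/set_mem[/and3P[fillT fcT rowsT] contT]|].
    have zT := sort_cells geq_total fillT rowsT contT.
    have fT := rows_tableau_word geq_trans geq_total fillT rowsT contT.
    have permw : perm_eq (tableau_word geq T) (row_word a).
      by apply: perm_tableau_word; case/andP: fillT => /eqP.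
    have srt : sorted (lex_le geq) (biword b (tableau_word geq T)).
      by rewrite -zT; apply: (sort_sorted (lex_le_total geq_total)).
    exists (tableau_word geq T); last by rewrite /f fT.
    rewrite !mem_filter mem_permutations srt permw andbT.
    have <- := rows_first_column geq_trans geq_total anti_geq lex_le_geq_next
      (comp_pos a) permw sab srt.
    by rewrite fT fcT.
  case=> w /inW[permw rgfw srt] ->; apply/mem_set.
  have [fillT rowsT contT] := rowsP geq_trans lex_le_geq_row permw sab srt.
  split=> //; apply/and3P; split=> //.
  by rewrite (rows_first_column geq_trans geq_total anti_geq lex_le_geq_next (comp_pos a)).
by rewrite card_fseq undup_id // map_inj_in_uniq // filter_uniq ?words_uniq.
Qed.

(** * Tableaux dominating a filling *)

(** At the first difference the partial sums have to compare in the same way.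
    Positivity excludes that b properly extends a. *)
Lemma lexle_partial_sums (b a : seq nat) : all (leq 1) b ->
    (forall i, sumn (take i b) <= sumn (take i a)) ->
  ((b : seqlexi nat) <= a)%O.
Proof.
elim: b a => [|y b IHb] a /= => [_ _|/andP[y_gt0 pb] le_ba]; first exact: lexi0s.
case: a le_ba => [|x a] le_ba.
  by have := le_ba 1; rewrite /= take0 addn0 leqNgt y_gt0.
have := le_ba 1; rewrite /= !take0 !addn0 => le_yx.
rewrite lexi_cons leEnat le_yx /=; apply/implyP => le_xy.
apply: IHb => // i; have := le_ba i.+1.
have -> : y = x by apply/anti_leq/andP.
by rewrite /= leq_add2l.
Qed.

Lemma sumn_take_content (s b : seq nat) i : all (leq 1) s ->
    (forall i, count_mem i.+1 s = nth 0 b i) ->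
  sumn (take i b) = count (leq^~ i) s.
Proof.
move=> ps cnt; elim: i => [|i IHi].
  rewrite take0 /= (eq_in_count (a2 := pred0)) ?count_pred0 // => x /(allP ps).
  by rewrite lt0n => /negPf; rewrite leqn0.
have -> : sumn (take i.+1 b) = sumn (take i b) + nth 0 b i.
  have [lt_ib|le_bi] := ltnP i (size b).
    by rewrite (take_nth 0) // sumn_rcons.
  by rewrite !take_oversize ?nth_default ?addn0 // ltnW.
rewrite IHi -cnt -[RHS]size_filter -(count_predC (leq^~ i)) !count_filter -!size_filter.
congr (_ + _); congr size; apply: eq_filter => x /=.
  by case: leqP => // le_xi; rewrite leqW.
by rewrite -ltnNge andbC eqn_leq.
Qed.

Lemma all2_leq_count (s0 s : seq nat) i :
  all2 leq s0 s -> count (leq^~ i) s <= count (leq^~ i) s0.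
Proof.
elim: s0 s => [|x s0 IHs] [|y s] //= /andP[le_xy /IHs]; apply: leq_add.
by case: (leqP y i) => // le_yi; rewrite (leq_trans le_xy).
Qed.

Lemma all2_leq_sumn (s0 s : seq nat) : all2 leq s0 s -> sumn s0 <= sumn s.
Proof. by elim: s0 s => [|x s0 IHs] [|y s] //= /andP[le_xy /IHs]; apply: leq_add. Qed.

Lemma all2_leq_perm (s0 s : seq nat) : all2 leq s0 s -> sumn s0 = sumn s -> s = s0.
Proof.
elim: s0 s => [|x s0 IHs] [|y s] //= /andP[le_xy le_s] eq_s.
have le_s' := all2_leq_sumn le_s.
have yx : y = x.
  apply/anti_leq; rewrite le_xy andbT -(leq_add2r (sumn s)) -eq_s leq_add2l.
  by [].
by move: eq_s; rewrite yx => /addnI /(IHs _ le_s)->.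
Qed.

(** Larger entries leave fewer entries <= i, that is, smaller partial sums of the
    content.  If the contents agree, then so do the sums of all entries, and a
    cellwise inequality with equal sums is an equality. *)
Lemma dominated_content (T0 T : seq (seq nat)) (b0 b : seq nat) :
    all (leq 1) b ->
    all (all (leq 1)) T0 -> all (all (leq 1)) T ->
    content T0 b0 -> content T b -> all2 (all2 leq) T0 T ->
  ((b : seqlexi nat) <= b0)%O /\ (b = b0 -> T = T0).
Proof.
rewrite -!all_flatten => pb p0 p c0 c le_T.
have le_f : all2 leq (flatten T0) (flatten T).
  elim: T0 T le_T {p0 p c0 c} => [|t0 T0 IHT] [|t T] //= /andP[le_t /IHT].
  by elim: t0 t le_t => [|x t0 IHt] [|y t] //= /andP[-> /IHt].
have le_c i := all2_leq_count i le_f.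
split; first apply: lexle_partial_sums => // i.
  by rewrite (sumn_take_content _ p c) (sumn_take_content _ p0 c0) le_c.
move=> b_b0; have perm_f : perm_eq (flatten T0) (flatten T).
  by apply: perm_content => // i; rewrite c0 c b_b0.
have := all2_leq_perm le_f (perm_sumn perm_f).
have : shape T = shape T0.
  elim: T0 T le_T {p0 p c0 c le_f le_c perm_f} => [|t0 T0 IHT] [|t T] //= /andP[le_t /IHT->].
  by move: le_t; rewrite all2E => /andP[/eqP->].
by move=> eq_sh eq_f; rewrite -(flattenK T) eq_sh eq_f flattenK.
Qed.

(** The smallest immaculate tableau of shape a is the one for i = 1; the general
    case serves in inductions on the rows. *)
Definition row_tableau (i : nat) (a : seq nat) : seq (seq nat) :=
  reshape a (labels i a).

Lemma row_tableau_cons i x a :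
  row_tableau i (x :: a) = nseq x i :: row_tableau i.+1 a.
Proof.
by rewrite /row_tableau /= take_size_cat ?drop_size_cat ?size_nseq.
Qed.

Lemma row_tableau_first_column i a : all (leq 1) a ->
  first_column (row_tableau i a) = iota i (size a).
Proof.
elim: a i => // x a IHa i; rewrite row_tableau_cons /= => /andP[x_gt0 /IHa->].
by case: x x_gt0.
Qed.

Lemma row_tableau_content a : content (row_tableau 1 a) a.
Proof.
move=> i; rewrite /row_tableau reshapeKr ?size_labels // -add1n.
exact: count_labels.
Qed.

Lemma row_tableau_immaculate a : all (leq 1) a -> immaculate a (row_tableau 1 a).
Proof.
move=> pa; rewrite /immaculate /filling -all_flatten /row_tableau.
rewrite reshapeKr ?size_labels // labels_ge reshapeKl ?size_labels // eqxx /=.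
rewrite -/(row_tableau 1 a) row_tableau_first_column // iota_ltn_sorted /=.
elim: a 1 {pa} => // x a IHa i; rewrite row_tableau_cons /= IHa andbT.
exact: sorted_nseq.
Qed.

(** The first entries of the rows form a strictly increasing sequence starting at
    i or above, and they bound the other entries of their rows from below. *)
Lemma row_tableau_le i T : all (leq 1) (shape T) ->
    path leq i (first_column T) -> sorted ltn (first_column T) ->
    all (sorted leq) T ->
  all2 (all2 leq) (row_tableau i (shape T)) T.
Proof.
elim: T i => // t T IHT i; rewrite [shape _]/= row_tableau_cons /=.
case/andP=> t_gt0 pT /andP[le_it path_i] srt /andP[srt_t srtT].
apply/andP; split.
  case: t t_gt0 le_it srt_t {path_i srt} => //= y t _ le_iy path_y; rewrite le_iy /=.
  have : all (leq i) t.
    apply: sub_all (order_path_min leq_trans path_y) => z; exact: leq_trans.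
  by elim: t {path_y} => //= z t IHt /andP[-> /IHt].
apply: IHT => //; last exact: path_sorted srt.
move: srt srtT pT; case: (T) => //= u U /andP[lt_tu pU] _ _.
rewrite (leq_ltn_trans le_it lt_tu) /=; apply: sub_path pU => p q; exact: ltnW.
Qed.

Lemma immaculate_dominated n (a b : composition n) T :
  immaculate a T -> content T b -> lexle b a /\ (b = a -> T = row_tableau 1 a).
Proof.
case/and3P=> fillT fcT rowsT contT; have /andP[/eqP shT pT] := fillT.
have /and3P[/andP[_ p0] _ _] := row_tableau_immaculate (comp_pos a).
have [|le_ba eq_T] := dominated_content (comp_pos b) p0 pT
  (@row_tableau_content a) contT.
  rewrite -{1}shT; apply: row_tableau_le => //; first by rewrite shT comp_pos.
  case: T shT pT fcT {fillT rowsT contT} => //= t T shT /andP[pt _] fcT.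
  rewrite (sub_path _ fcT) => [|p q /ltnW //]; rewrite andbT.
  have : 0 < size t by apply: (allP (comp_pos a)); rewrite -shT mem_head.
  by case: t pt {shT fcT} => //= y t /andP[].
by split=> // eq_ba; apply: eq_T; rewrite eq_ba.
Qed.

Lemma K_neq0 n (a b : composition n) : K a b != 0 -> lexle b a.
Proof.
rewrite -lt0n cardfs_gt0 => /fset0Pn[T].
rewrite in_fset_set; last exact: immaculate_set_finite.
by case/set_mem => immT /(immaculate_dominated immT)[].
Qed.

Lemma K_diag n (a : composition n) : K a a = 1.
Proof.
rewrite /K; have -> : immaculate_set a a = [set row_tableau 1 a]%classic.
  apply/seteqP; split=> [T [immT /(immaculate_dominated immT)[_]]|_ ->].
    by move=> ->.
  split; last exact: row_tableau_content.
  exact/row_tableau_immaculate/comp_pos.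
by rewrite fset_set1 cardfs1.
Qed.

Definition column_tableau (a : seq nat) : seq (seq nat) :=
  [seq iota 1 x | x <- a].

(** The entry i occurs once in each row of length at least i. *)
Lemma column_tableau_content a : content (column_tableau a) (columns a).
Proof.
move=> i; transitivity (count (leq i.+1) a).
  rewrite count_flatten -map_comp -sumn_count; congr sumn; apply: eq_map => x /=.
  by rewrite count_uniq_mem ?iota_uniq // mem_iota add1n ltnS.
rewrite /columns; have [lt_i|ge_i] := ltnP i (\max_(x <- a) x).
  by rewrite (nth_map 0) ?size_iota // nth_iota.
rewrite nth_default ?size_map ?size_iota //.
rewrite (eq_in_count (a2 := pred0)) ?count_pred0 // => x xa /=.
rewrite ltnNge (leq_trans _ ge_i) //; exact: leq_bigmax_seq.
Qed.

Lemma column_tableau_row_strict a : all (leq 1) a ->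
  row_strict_immaculate a (column_tableau a).
Proof.
move=> pa; apply/and3P; split.
- apply/andP; split.
    rewrite /shape -map_comp -{2}[a]map_id; apply/eqP/eq_map => x /=.
    exact: size_iota.
  by rewrite all_map; apply/allP=> x _; apply/allP=> y; rewrite mem_iota => /andP[].
- rewrite /first_column -map_comp; case: a pa => //= x a /andP[x_gt0].
  have -> : head 0 (iota 1 x) = 1 by case: x x_gt0.
  by elim: a => //= y a IHa /andP[y_gt0 /IHa]; case: y y_gt0.
by rewrite all_map; apply/allP=> x _; apply: iota_ltn_sorted.
Qed.

Lemma column_tableau_le T : all (all (leq 1)) T -> all (sorted ltn) T ->
  all2 (all2 leq) (column_tableau (shape T)) T.
Proof.
elim: T => //= t T IHT /andP[pt pT] /andP[srt_t srtT]; rewrite IHT // andbT.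
have : path ltn 0 t by case: t pt srt_t => //= y t /andP[-> _].
elim: t 0 {pt srt_t} => //= y t IHt i /andP[lt_iy path_y].
rewrite lt_iy; apply: IHt; case: t path_y => //= z t /andP[lt_yz ->].
by rewrite (leq_ltn_trans lt_iy).
Qed.

Lemma row_strict_dominated n (a b : composition n) T :
    row_strict_immaculate a T -> content T b ->
  lexle b (beta_psi a) /\ (b = beta_psi a -> T = column_tableau a).
Proof.
case/and3P=> /andP[/eqP shT pT] _ rowsT contT.
have /and3P[/andP[_ p0] _ _] := column_tableau_row_strict (comp_pos a).
have [|le_b eq_T] := dominated_content (comp_pos b) p0 pT
  (@column_tableau_content a) contT.
  by rewrite -{1}shT; apply: column_tableau_le.
by split=> // eq_b; apply: eq_T; rewrite eq_b.
Qed.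

Local Open Scope ring_scope.

(** * Lexicographically unitriangular changes of basis *)

Lemma lexlexx n (a : composition n) : lexle a a.
Proof. exact: Order.POrderTheory.lexx. Qed.

Lemma lexle_trans n : transitive (@lexle n).
Proof. move=> b a c; exact: Order.POrderTheory.le_trans. Qed.

Lemma lexle_anti n : antisymmetric (@lexle n).
Proof. by move=> a b /Order.POrderTheory.le_anti/val_inj. Qed.

Section Triangular.
Variables (n : nat) (B : composition n -> qsym) (k : composition n -> composition n -> int).
Hypothesis B_def : forall b, B b = \sum_d k b d *: M d.
Hypothesis k_diag : forall b, k b b = 1.
Hypothesis k_lex : forall b d, k b d != 0 -> lexle d b.

(** Subtract from B b the lower terms k b d *: M d, which have triangular
    expansions by induction on the number of compositions below b. *)
Lemma M_triangular b : exists c : {ffun composition n -> int},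
  [/\ M b = \sum_d c d *: B d, c b = 1 & forall d, c d != 0 -> lexle d b].
Proof.
have [m] := ubnP #|[pred d | lexle d b]|; elim: m b => // m IHm b; rewrite ltnS => le_m.
have /choice[P PE] : forall d, exists c : {ffun composition n -> int},
    lexle d b && (d != b) ->
    M d = \sum_e c e *: B e /\ forall e, c e != 0 -> lexle e d.
  move=> d; case: (boolP (lexle d b && (d != b))) => [/andP[le_db ne_db]|_]; last by exists 0.
  have [|c [M_c _ c_lex]] := IHm d; last by exists c.
  apply: leq_trans le_m; apply/proper_card/properP; split.
    by apply/fintype.subsetP => e; rewrite !inE => /lexle_trans; apply.
  exists b; rewrite !inE ?lexlexx //; apply: contra ne_db => le_bd.
  by apply/eqP/lexle_anti; rewrite le_db.
exists [ffun e => (e == b)%:R - \sum_(d | lexle d b && (d != b)) k b d * P d e].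
split=> [||e]; rewrite ?ffunE.
- have {1}-> : M b = B b - \sum_(d | lexle d b && (d != b)) k b d *: M d.
    rewrite B_def (bigD1 b) //= k_diag scale1r.
    rewrite [X in _ + X - _](bigID (fun d => lexle d b)) /=.
    rewrite [X in _ + (_ + X) - _]big1 => [|d /andP[_ nle_db]].
      rewrite addr0 (eq_bigl (fun d => lexle d b && (d != b))) ?addrK // => d.
      exact: andbC.
    by have [->|/k_lex le_db] := eqVneq (k b d) 0; rewrite ?scale0r // le_db in nle_db *.
  under [RHS]eq_bigr => e _ do rewrite ffunE scalerBl scaler_suml.
  rewrite sumrB; congr (_ - _).
    rewrite (bigD1 b) //= eqxx scale1r big1 ?addr0 // => e /negPf->.
    by rewrite scale0r.
  rewrite exchange_big; apply: eq_bigr => d le_d; have [-> _] := PE d le_d.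
  by rewrite scaler_sumr; apply: eq_bigr => e _; rewrite scalerA.
- rewrite eqxx big1 ?subr0 // => d le_d; have [_ P_lex] := PE d le_d.
  have [->|/P_lex le_bd] := eqVneq (P d b) 0; first by rewrite mulr0.
  case/andP: le_d => le_db /eqP[]; apply/lexle_anti.
  by rewrite le_db.
apply: contraR => nle_eb; rewrite big1 ?subr0 => [|d le_d].
  by rewrite (negPf (_ : e != b)) //; apply: contra nle_eb => /eqP->; rewrite lexlexx.
have [_ P_lex] := PE d le_d; have [->|/P_lex le_ed] := eqVneq (P d e) 0.
  by rewrite mulr0.
by case/andP: le_d => le_db _; rewrite (lexle_trans le_ed le_db) in nle_eb.
Qed.

(** The coefficient of M b in a combination of the B d is that of B b plus
    contributions of the B d with d above b, which agree by induction on the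
    number of compositions above b. *)
Lemma triangular_free (c c' : {ffun composition n -> int}) :
  \sum_b c b *: B b = \sum_b c' b *: B b -> c = c'.
Proof.
have expand (e : {ffun composition n -> int}) :
    \sum_b e b *: B b = \sum_d (\sum_b e b * k b d) *: M d.
  under eq_bigr => b _ do rewrite B_def scaler_sumr.
  rewrite exchange_big; apply: eq_bigr => d _; rewrite scaler_suml.
  by apply: eq_bigr => b _; rewrite scalerA.
rewrite !expand => /M_free eq_ck; apply/ffunP => b.
have [m] := ubnP #|[pred d | lexle b d]|; elim: m b => // m IHm b; rewrite ltnS => le_m.
have := eq_ck b; rewrite (bigD1 b) // [RHS](bigD1 b) //= k_diag !mulr1.
rewrite (eq_bigr (fun d => c' d * k d b)) => [/addIr //|d ne_db].
have [->|/k_lex le_bd] := eqVneq (k d b) 0; rewrite ?mulr0 // IHm //.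
apply: leq_trans le_m; apply/proper_card/properP; split.
  by apply/fintype.subsetP => e; rewrite !inE; apply: lexle_trans.
exists b; rewrite !inE ?lexlexx //; apply: contra ne_db => le_db.
by apply/eqP/lexle_anti; rewrite le_db.
Qed.

(** Since M b is B b plus combinations of lower B d, the largest index of a
    combination of the M d survives with its coefficient. *)
Lemma triangular_leading (g : composition n -> int) b :
  g b = 1 -> (forall d, g d != 0 -> lexle d b) ->
  exists c : {ffun composition n -> int},
    [/\ unique (expansion B (\sum_d g d *: M d)) c, leading_index c b & c b = 1].
Proof.
move=> g_b g_lex; have /choice[P PE] := M_triangular.
pose c := [ffun e => \sum_d g d * P d e].
have c_lex e : c e != 0 -> lexle e b.
  apply: contraR => nle_eb; rewrite ffunE big1 // => d _.
  have [->|/g_lex le_db] := eqVneq (g d) 0; first by rewrite mul0r.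
  have [_ _ P_lex] := PE d; have [->|/P_lex le_ed] := eqVneq (P d e) 0.
    by rewrite mulr0.
  by rewrite (lexle_trans le_ed le_db) in nle_eb.
(* M d contributes to the coefficient of B b only if d <= b <= d. *)
have c_b : c b = 1.
  rewrite ffunE (bigD1 b) //= g_b mul1r; have [_ -> _] := PE b.
  rewrite big1 ?addr0 // => d ne_db.
  have [->|/g_lex le_db] := eqVneq (g d) 0; first by rewrite mul0r.
  have [_ _ P_lex] := PE d; have [->|/P_lex le_bd] := eqVneq (P d b) 0.
    by rewrite mulr0.
  by case/eqP: ne_db; apply: lexle_anti; rewrite le_db.
have c_exp : \sum_d g d *: M d = \sum_e c e *: B e.
  under [RHS]eq_bigr => e _ do rewrite ffunE scaler_suml.
  rewrite exchange_big; apply: eq_bigr => d _; have [{1}-> _ _] := PE d.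
  by rewrite scaler_sumr; apply: eq_bigr => e _; rewrite scalerA.
exists c; split=> //; last by split=> [|d /eqP/c_lex //]; rewrite c_b.
by split=> // c'; rewrite /expansion c_exp => /triangular_free.
Qed.

End Triangular.

(** * Expansions over words *)

Definition ascents (w : seq nat) : seq nat :=
  [seq k <- iota 1 (size w).-1 | (nth 0 w k.-1 < nth 0 w k)%N].

Definition ascent_comp n (w : seq nat) : composition n := Comp_of_set n (ascents w).

Lemma size_words n (a : composition n) w : w \in words a -> size w = n.
Proof.
rewrite mem_filter mem_permutations => /andP[_ /perm_size->].
by rewrite size_row_word comp_sumn.
Qed.

Lemma mem_ascent_comp n w k : size w = n -> (0 < k < n)%N ->
  (k \in psums (ascent_comp n w)) = (nth 0 w k.-1 < nth 0 w k)%N.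
Proof.
move=> sw /andP[k_gt0 lt_kn]; rewrite mem_psums_Comp_of_set ?k_gt0 //.
rewrite mem_filter mem_iota add1n sw (ltn_predK lt_kn) k_gt0 lt_kn; exact: andbT.
Qed.

(** Inside a block of b the biword is sorted only if R holds, so the places where
    R fails have to be partial sums of b. *)
Lemma refines_biword (R : rel nat) n (a b : composition n) w : size w = n ->
    (forall k, (0 < k < n)%N -> (k \in psums a) = ~~ R (nth 0 w k.-1) (nth 0 w k)) ->
  refines b a = sorted (lex_le R) (biword b w).
Proof.
move=> sw aE; rewrite sorted_biword ?comp_pos ?comp_sumn //.
have iotaE k : (k \in iota 1 n.-1) = (0 < k < n)%N.
  by rewrite mem_iota add1n; case: (n) => [|m] //; case: k => [|[|k]].
apply/refinesP/allP => sub k; first rewrite iotaE => kn.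
  by have := sub k kn; rewrite aE //; case: (R _ _) => //= ->.
by move=> kn; rewrite aE //; have := sub k; rewrite iotaE => /(_ kn)/orP[->|].
Qed.

Lemma sum_count_M n (W : seq (seq nat)) (P : composition n -> pred (seq nat)) :
  \sum_(b : composition n) (count (P b) W)%:R *: M b =
  \sum_(w <- W) \sum_(b : composition n | P b w) M b.
Proof.
rewrite (exchange_big_dep xpredT) //=; apply: eq_bigr => b _.
by rewrite -big_filter big_const_seq count_predT size_filter iter_addr_0 scaler_nat.
Qed.

Lemma dual_immaculate_F n (a : composition n) :
  dual_immaculate a = \sum_(w <- words a) F (ascent_comp n w).
Proof.
rewrite /dual_immaculate; under eq_bigr => b _ do rewrite K_words.
rewrite sum_count_M big_seq [RHS]big_seq; apply: eq_bigr => w /size_words sw.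
apply: eq_bigl => b; apply/esym/refines_biword => // k kn.
by rewrite mem_ascent_comp // ltnNge.
Qed.

Lemma psi_dual_immaculate n (a : composition n) :
  psi (dual_immaculate a) = \sum_(b : composition n)
    (count (fun w => sorted (lex_le ltn) (biword b w)) (words a))%:R *: M b.
Proof.
rewrite dual_immaculate_F raddf_sum sum_count_M big_seq [RHS]big_seq.
apply: eq_bigr => w /size_words sw; rewrite /= psiF; apply: eq_bigl => b.
apply: refines_biword => // k kn.
by rewrite mem_psums_compl // mem_ascent_comp.
Qed.

(** * Words of row-strict tableaux *)

(** A word that is strictly increasing inside the blocks of b comes from a
    row-strict tableau of content b, to which the bound by the column tableau
    applies. *)
Lemma row_strict_words_lex n (a b : composition n) w :
    w \in words a -> sorted (lex_le ltn) (biword b w) ->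
  lexle b (beta_psi a) /\ (b = beta_psi a -> w = tableau_word leq (column_tableau a)).
Proof.
rewrite mem_filter mem_permutations => /andP[rgf_w perm_w] srt.
have sab : sumn a = sumn b by rewrite !comp_sumn.
(* Decoding relies on a total order, which the strict one is not. *)
have srt' : sorted (lex_le leq) (biword b w).
  apply: sub_sorted srt => p q /orP[lt_pq|/andP[eq_pq /ltnW le_pq]].
    by rewrite /lex_le lt_pq.
  by rewrite /lex_le eq_pq le_pq orbT.
have [fillT rowsT contT] := rowsP ltn_trans lex_le_ltn_row perm_w sab srt.
have rsT : row_strict_immaculate a (rows (size a) (biword b w)).
  apply/and3P; split=> //.
  by rewrite (rows_first_column leq_trans leq_total anti_leq lex_le_leq_next (comp_pos a)).
have [le_b T_eq] := row_strict_dominated rsT contT; split=> // /T_eq <-.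
by rewrite (tableau_wordK leq_trans leq_total anti_leq perm_w sab).
Qed.

Lemma column_word n (a : composition n) (w := tableau_word leq (column_tableau a)) :
  w \in words a /\ sorted (lex_le ltn) (biword (beta_psi a) w).
Proof.
have /and3P[fillT fcT rowsT] := column_tableau_row_strict (comp_pos a).
have contT := @column_tableau_content a.
have rowsT' : all (sorted leq) (column_tableau a).
  by apply: sub_all rowsT => t; apply: sub_sorted => x y /ltnW.
have zT := sort_cells leq_total fillT rowsT' contT.
have wT := rows_tableau_word leq_trans leq_total fillT rowsT' contT.
have sab : sumn a = sumn (beta_psi a) by rewrite !comp_sumn.
have perm_w : perm_eq w (row_word a).
  by apply: perm_tableau_word; case/andP: fillT => /eqP.
have srt : sorted (lex_le leq) (biword (beta_psi a) w).
  by rewrite -zT; apply: (sort_sorted (lex_le_total leq_total)).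
split.
  rewrite mem_filter mem_permutations perm_w andbT.
  rewrite -(rows_first_column leq_trans leq_total anti_leq lex_le_leq_next
    (comp_pos a) perm_w sab srt).
  by rewrite wT.
(* The rows being strict, no cell is repeated, so the blocks are strict too. *)
have uz : uniq (biword (beta_psi a) w).
  rewrite -zT sort_uniq /cells; apply: allpairs_uniq_dep; first exact: iota_uniq.
    move=> r; rewrite mem_iota => /= lt_r.
    apply: (sorted_uniq ltn_trans ltnn); apply: (allP rowsT); exact: mem_nth.
  by move=> [r x] [s y] _ _ /= [-> ->].
apply/(sortedP (0, 0)%N) => i lt_i.
have := elimT (sortedP (0, 0)%N) srt i lt_i.
have : nth (0, 0)%N (biword (beta_psi a) w) i != nth (0, 0)%N (biword (beta_psi a) w) i.+1.
  by rewrite nth_uniq // ?ltn_eqF // ltnW.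
case: (nth _ _ i) (nth _ _ i.+1) => [x r] [y s].
rewrite /lex_le /= xpair_eqE; case: ltngtP => //= _; by rewrite ltn_neqAle => ->.
Qed.

(** * The leading term *)

Theorem proposition4p7 (n : nat) (n_gt0 : (1 <= n)%N) (alpha : composition n) :
  (exists c : {ffun composition n -> int},
     [/\ unique (expansion (@dual_immaculate n) (psi (dual_immaculate alpha))) c,
         leading_index c (beta_psi alpha)
       & c (beta_psi alpha) = 1]) /\
  (exists T : seq (seq nat),
     unique (fun T' : seq (seq nat) =>
       row_strict_immaculate alpha T' /\ content T' (beta_psi alpha)) T /\
     forall i j : nat, (i < size alpha)%N -> (j < nth 0%N alpha i)%N ->
       nth 0%N (nth [::] T i) j = j.+1).
Proof.
split.
  rewrite psi_dual_immaculate.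
  apply: (triangular_leading (k := fun a b => (K a b)%:R)) => [b|b|b d||d].
  - by [].
  - by rewrite K_diag.
  - by rewrite Num.Theory.pnatr_eq0 => /K_neq0.
  - rewrite -size_filter; set W := [seq w <- _ | _].
    have [w_in w_srt] := column_word alpha; set w := tableau_word _ _ in w_in w_srt.
    have W1 : W =i [:: w].
      move=> v; rewrite mem_filter inE; apply/andP/eqP => [[srt_v v_in]|-> //].
      by have [_ /(_ erefl)] := row_strict_words_lex v_in srt_v.
    have/perm_size-> : perm_eq W [:: w].
      by apply: uniq_perm => //; rewrite filter_uniq ?words_uniq.
    by [].
  rewrite Num.Theory.pnatr_eq0 -lt0n -has_count => /hasP[w w_in srt].
  by have [] := row_strict_words_lex w_in srt.
exists (column_tableau alpha); split; first split.
- split; last exact: column_tableau_content.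
  exact/column_tableau_row_strict/comp_pos.
- by move=> T [/row_strict_dominated rsT /rsT[_ ->]].
move=> i j lt_i lt_j.
by rewrite (nth_map 0%N) // nth_iota.
Qed.
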